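(* Consider a random variable $X$ with a distribution $\mathbb{P}$ in $\mathcal{P}_{(\mu,b,d)}$. Then, for $t\in[0,b]$, $$\inf_{\mathbb{P}\in\mathcal{P}_{(\mu,b,d)}}\mathbb{P}(X\ge t)=\inf_{\mathbb{P}\in\mathcal{P}_{(\mu,b,d)}}\mathbb{P}(X>t)=\begin{cases}1-\frac{d}{2(\mu-t)}, & t\in[0,\tau_1],\\ \frac{d}{2(b-\mu)}, & t\in[\tau_1,\mu],\\ \frac{\mu-t}{b-t}+\frac{dt}{2\mu(b-t)}, & t\in[\mu,\tau_2],\\ 0, & t\in[\tau_2,b],\end{cases}$$ with $\tau_1$ and $\tau_2$ given by $$\tau_1=\mu-\frac{d(b-\mu)}{2(b-\mu)-d},\qquad \tau_2=\mu+\frac{d\mu}{2\mu-d}.$$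
   Context: Let $\mu,b,d\in\mathbb{R}_+$. $\mathcal{P}_{(\mu,b,d)}$ is the set of all probability measures $\mathbb{P}$ on the Borel $\sigma$-algebra of $[0,b]$ (distributions of a random variable $X$) such that $\mathbb{P}(X\in[0,b])=1$, $\mathbb{E}_{\mathbb{P}}[X]=\mu$ and $\mathbb{E}_{\mathbb{P}}[|X-\mu|]=d$.
   Formalization: Here μ, b, d > 0 and the set of distributions is assumed non-empty; the equality of inf P(X≥t) with inf P(X>t) is asserted only for t > 0 and not at t = b when τ2 = b, since there P(X≥0) = 1 and P(X≥b) = μ/b contradict the printed formula. *)

(* Defs.v *)
From HB Require Import structures.
From mathcomp Require Import all_boot all_order all_algebra.
From mathcomp Require Import all_classical all_reals all_analysis.
Set Implicit Arguments.
Unset Strict Implicit.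
Unset Printing Implicit Defensive.
Import Order.TTheory GRing.Theory Num.Theory.
Import numFieldNormedType.Exports.
Local Open Scope classical_set_scope.
Local Open Scope ring_scope.

(* A law on [0, b] is encoded as a Borel probability measure on R giving mass 1
   to [0, b]; the random variable X is the identity on R. *)
Definition ambiguity_set (R : realType) (mu b d : R) :
    set (probability (measurableTypeR R) R) :=
  [set P : probability (measurableTypeR R) R |
    [/\ P `[0, b]%classic = 1%E,
        ('E_P[fun x : measurableTypeR R => (x : R)] = mu%:E)%E &
        ('E_P[fun x : measurableTypeR R => (`|(x : R) - mu|)%R] = d%:E)%E]].

Definition inf_ge (R : realType) (mu b d t : R) : \bar R :=
  ereal_inf [set (P : probability (measurableTypeR R) R)
                   [set x : measurableTypeR R | t <= (x : R)]
            | P in ambiguity_set mu b d].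

Definition inf_gt (R : realType) (mu b d t : R) : \bar R :=
  ereal_inf [set (P : probability (measurableTypeR R) R)
                   [set x : measurableTypeR R | t < (x : R)]
            | P in ambiguity_set mu b d].

Definition tau1 (R : realType) (mu b d : R) : R :=
  mu - d * (b - mu) / (2 * (b - mu) - d).

Definition tau2 (R : realType) (mu d : R) : R :=
  mu + d * mu / (2 * mu - d).

(* The four closed ranges overlap at tau1, mu and tau2; the value asserted by
   each range is required there.  When tau2 = b, the third expression at t = b
   is 0 / 0, which is 0 here, in agreement with the fourth one. *)
Definition tail_value (R : realType) (mu b d t : R) (v : \bar R) : Prop :=
  [/\ 0 <= t <= tau1 mu b d -> v = (1 - d / (2 * (mu - t)))%:E,
      tau1 mu b d <= t <= mu -> v = (d / (2 * (b - mu)))%:E,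
      mu <= t <= tau2 mu d ->
        v = ((mu - t) / (b - t) + d * t / (2 * mu * (b - t)))%:E &
      tau2 mu d <= t <= b -> v = 0%E].

(* Main.v *)
Require Import Defs.
From HB Require Import structures.
From mathcomp Require Import all_boot all_order all_algebra.
From mathcomp Require Import all_classical all_reals all_analysis.
From mathcomp Require Import measurable_realfun ring lra.
Set Implicit Arguments.
Unset Strict Implicit.
Unset Printing Implicit Defensive.
Import Order.TTheory GRing.Theory Num.Theory.
Import numFieldNormedType.Exports.
Local Open Scope classical_set_scope.
Local Open Scope ring_scope.

(** The constraints fix the expectations of 1, X and |X - mu|; equivalently, of 1,
X and (X - mu)^+, and E (X - mu)^+ = E (mu - X)^+ = d / 2.  The proof is linear
programming duality made explicit.

Lower bound. If a + c x + e |x - mu| lies below the indicator of x > t on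
[0, b], then taking expectations gives a + c mu + e d <= P(X > t) for every law
P of the class ([le_expectation_tail]).  The functions that do the job are
- 1 - (mu - x)^+ / (mu - t), for t below tau1;
- (x - mu)^+ / (b - mu), for t between tau1 and mu;
- the function that is linear on [0, mu] and on [mu, b] and takes the values
  0, 0, 1 at 0, t, b, for t between mu and tau2;
- 0, for t above tau2.

Attainment. A law sitting on the points where this function touches the
indicator reaches the bound.  It has atoms at t and at one point above mu in the
first range, at tau1 and b in the second one, at 0, t and b in the third one,
and at 0 and tau2 in the last one ([inf_gt_le_three_atoms]).  That these points
and weights are admissible amounts to the inequality d b <= 2 mu (b - mu), which
is equivalent both to 0 <= tau1 and to tau2 <= b, and which follows from the
existence of one law in the class ([ambiguity_set_feasible]): |x - mu| lies below
its chord on [0, b].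

Weak tails. For s < t the events X > t, X >= t and X > s increase, so
inf P(X > t) <= inf P(X >= t) <= inf P(X > s).  The explicit value of the
strict infimum is left-continuous wherever the theorem claims equality, and
letting s increase to t closes the gap ([inf_ge_eq_inf_gt]); no extremal law is
needed for the weak tail. *)

(** * Finitely supported laws *)

(** Signed test functions are split into positive and negative parts because the
integral against a sum of scaled Dirac masses is computed for nonnegative
functions. *)
Lemma finitely_supported_law (R : realType) (N : nat) (w : nat -> {nonneg R})
    (a : nat -> R) :
  \sum_(i < N) (w i)%:num = 1 ->
  exists P : probability (measurableTypeR R) R,
    (forall A, P A = (\sum_(i < N) (w i)%:num * \1_A (a i))%:E) /\
    (forall f : measurableTypeR R -> R, measurable_fun setT f ->
       ('E_P[f] = (\sum_(i < N) (w i)%:num * f (a i))%:E)%E).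
Proof.
move=> w1.
pose atom i := mscale (w i) (\d_(a i : measurableTypeR R)).
pose m := msum (fun i => atom i : measure _ R) N.
have mE A : m A = (\sum_(i < N) (w i)%:num * \1_A (a i))%:E.
  by rewrite /m /msum -sumEFin; apply: eq_bigr.
have m1 : m setT = 1%E.
  rewrite mE -[RHS]/(1%:E) -w1; congr EFin; apply: eq_bigr => i _.
  by rewrite indicT mulr1.
pose P : probability (measurableTypeR R) R :=
  HB.pack m (Measure_isProbability.Build _ _ _ m m1).
have ge0E (f : measurableTypeR R -> R) : measurable_fun setT f ->
    (forall x, 0 <= f x) ->
    (\int[P]_x (f x)%:E = (\sum_(i < N) (w i)%:num * f (a i))%:E)%E.
  move=> mf f0.
  have mEf : measurable_fun setT (EFin \o f) by exact/measurable_EFinP.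
  rewrite ge0_integral_measure_sum//; last by move=> x _; rewrite lee_fin.
  rewrite -sumEFin; apply: eq_bigr => i _.
  rewrite ge0_integral_mscale//; last by move=> x _; rewrite lee_fin.
  by rewrite integral_dirac// diracT mul1e.
exists P; split=> // f mf.
rewrite unlock integralE.
under eq_integral do rewrite funeposE -EFin_max.
under [X in (_ - X)%E]eq_integral do rewrite funenegE -EFinN -EFin_max.
rewrite !ge0E; last 4 first.
- exact: measurable_maxr (measurable_funN mf) (measurable_cst _).
- by move=> x; rewrite le_max lexx orbT.
- exact: measurable_maxr mf (measurable_cst _).
- by move=> x; rewrite le_max lexx orbT.
rewrite -EFinB -sumrB; congr EFin; apply: eq_bigr => i _.
rewrite -mulrBr; congr (_ * _).
by case: (lerP 0 (f (a i))) => h; rewrite /Num.max; case: ifPn; lra.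
Qed.

(** * Expectation bounds on tail probabilities *)

Lemma measurable_gt_tail (R : realType) (t : R) :
  measurable [set x : measurableTypeR R | t < (x : R)].
Proof.
rewrite [X in measurable X](_ : _ = `]t, +oo[%classic); last first.
  by apply/seteqP; split=> x; rewrite /= in_itv /= andbT.
exact: measurable_itv.
Qed.

Lemma measurable_ge_tail (R : realType) (t : R) :
  measurable [set x : measurableTypeR R | t <= (x : R)].
Proof.
rewrite [X in measurable X](_ : _ = `[t, +oo[%classic); last first.
  by apply/seteqP; split=> x; rewrite /= in_itv /= andbT.
exact: measurable_itv.
Qed.

(** Weak duality: every function of the span of 1, x and |x - mu| has the same
expectation under all laws of the class, so a minorant of the indicator on
[0, b] yields a bound common to all of them. *)
Lemma le_expectation_tail (R : realType) (mu b d t a c e : R)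
    (P : probability (measurableTypeR R) R) :
  ambiguity_set mu b d P ->
  (forall x, 0 <= x <= b -> a + c * x + e * `|x - mu| <= (t < x)%R%:R) ->
  ((a + c * mu + e * d)%:E <= P [set x : measurableTypeR R | (t < x)%R])%E.
Proof.
move=> [P0b]; rewrite !unlock => Emean Emad hle.
pose dev (x : measurableTypeR R) : R := `|x - mu|.
have mT : measurable [set: measurableTypeR R] by [].
have mdev : measurable_fun setT dev.
  by apply: measurableT_comp => //; exact: measurable_funB.
(* A finite absolute deviation makes X - mu, hence X, integrable. *)
have idev : P.-integrable setT (EFin \o dev).
  apply/integrableP; split; first exact/measurable_EFinP.
  under eq_integral => x _ do rewrite /= /dev ger0_norm//.
  by rewrite Emad ltry.
have iX : P.-integrable setT (fun x : measurableTypeR R => (x : R)%:E).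
  have iB : P.-integrable setT (EFin \o (fun x : measurableTypeR R => (x : R) - mu)).
    apply: le_integrable idev => //.
      by apply/measurable_EFinP; exact: measurable_funB.
    by move=> x _; rewrite /= /dev normr_id.
  have ic : P.-integrable setT (EFin \o cst mu) by exact: finite_measure_integrable_cst.
  apply: eq_integrable (integrableD mT iB ic) => // x _ /=.
  by rewrite -EFinD subrK.
pose f (x : measurableTypeR R) : R := a + c * x + e * dev x.
have ia : P.-integrable setT (EFin \o cst a) by exact: finite_measure_integrable_cst.
have ic := integrableZl mT c iX.
have ie := integrableZl mT e idev.
have iac := integrableD mT ia ic.
have fE : EFin \o f = (fun x : measurableTypeR R =>
   ((EFin \o cst a) x + c%:E * (x : R)%:E) + e%:E * (EFin \o dev) x)%E.
  by apply/funext => x /=; rewrite /f !EFinD !EFinM.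
have intf : P.-integrable setT (EFin \o f) by rewrite fE; exact: integrableD.
have Ef : (\int[P]_x (EFin \o f) x = (a + c * mu + e * d)%:E)%E.
  rewrite fE integralD// integralD// !integralZl// Emean.
  rewrite [X in (_ + _ * X)%E](_ : _ = d%:E)//.
  rewrite [X in (X + _ + _)%E](_ : _ = a%:E) ?EFinD ?EFinM//.
  by have := expectation_cst P a; rewrite unlock.
pose A : set (measurableTypeR R) := [set x : measurableTypeR R | (t < x)%R].
have mA : measurable A by exact: measurable_gt_tail.
have i1 : P.-integrable setT (EFin \o \1_A) by exact: integrable_indic.
have m0b : measurable (`[0, b]%classic : set (measurableTypeR R)).
  exact: measurable_itv.
(* The comparison is only assumed on [0, b], whose complement is null. *)
have out0 : P (~` `[0, b]%classic) = 0.
  by rewrite probability_setC// P0b subee.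
have mC : measurable (~` `[0, b]%classic : set (measurableTypeR R)) by exact: measurableC.
rewrite -Ef -[X in (_ <= P X)%E]setIT -integral_indic//.
rewrite (negligible_integral mC mT intf out0) (negligible_integral mC mT i1 out0).
have mD : measurable (setT `\` ~` `[0, b]%classic : set (measurableTypeR R)).
  exact: measurableD.
apply: le_integral => //.
- exact: integrableS intf.
- exact: integrableS i1.
move=> x; rewrite inE => -[_ /contrapT] /=; rewrite in_itv /= => xb.
rewrite lee_fin /indic; have := hle x xb.
by rewrite [x \in A](_ : _ = (t < x)%R)//; apply/idP/idP; rewrite inE.
Qed.

Lemma le_inf_gt (R : realType) (mu b d t a c e : R) :
  (forall x, 0 <= x <= b -> a + c * x + e * `|x - mu| <= (t < x)%R%:R) ->
  ((a + c * mu + e * d)%:E <= inf_gt mu b d t)%E.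
Proof.
by move=> hle; apply: le_ereal_inf_tmp => _ [P Pin <-];
  exact: le_expectation_tail Pin hle.
Qed.

(** Atoms may coincide and weights may vanish, so this also serves for the
two-point extremal laws. *)
Lemma inf_gt_le_three_atoms (R : realType) (mu b d t x0 x1 x2 w0 w1 w2 : R) :
  0 <= w0 -> 0 <= w1 -> 0 <= w2 -> w0 + w1 + w2 = 1 ->
  0 <= x0 <= b -> 0 <= x1 <= b -> 0 <= x2 <= b ->
  w0 * x0 + w1 * x1 + w2 * x2 = mu ->
  w0 * `|x0 - mu| + w1 * `|x1 - mu| + w2 * `|x2 - mu| = d ->
  (inf_gt mu b d t <=
   (w0 * (t < x0)%R%:R + w1 * (t < x1)%R%:R + w2 * (t < x2)%R%:R)%:E)%E.
Proof.
move=> w0_ge0 w1_ge0 w2_ge0 w_sum x0b x1b x2b mean mad.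
pose w i : {nonneg R} :=
  nth (NngNum w0_ge0) [:: NngNum w0_ge0; NngNum w1_ge0; NngNum w2_ge0] i.
pose x i := nth x0 [:: x0; x1; x2] i.
have sum3 (F : R -> R) : \sum_(i < 3) (w i)%:num * F (x i) =
    w0 * F x0 + w1 * F x1 + w2 * F x2.
  by rewrite !big_ord_recr big_ord0 /= add0r.
have wx_sum : \sum_(i < 3) (w i)%:num = 1.
  by have := sum3 (cst 1); under eq_bigr do rewrite mulr1; rewrite !mulr1 => ->.
have [P [Pset Pmean]] := finitely_supported_law x wx_sum.
have PE (B : set (measurableTypeR R)) (p : pred R) : (forall z, B z <-> p z) ->
    P B = (w0 * (p x0)%:R + w1 * (p x1)%:R + w2 * (p x2)%:R)%:E.
  move=> Bp; rewrite Pset (sum3 \1_B).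
  suff indE y : \1_B y = (p y)%:R :> R by rewrite !indE.
  by rewrite indicE; congr (nat_of_bool _)%:R; apply/idP/idP; rewrite inE => /Bp.
rewrite -(PE [set x : measurableTypeR R | t < (x : R)] (fun z => t < z)%R)//.
apply: ereal_inf_lbound; exists P => //; split.
- rewrite (PE _ (fun z => 0 <= z <= b)%R); last by move=> z; rewrite /= in_itv.
  by rewrite x0b x1b x2b !mulr1 w_sum.
- by rewrite Pmean// (sum3 id) mean.
- rewrite Pmean ?(sum3 (fun y => `|y - mu|)) ?mad//.
  by apply: measurableT_comp => //; exact: measurable_funB.
Qed.

Lemma inf_gt_le_inf_ge (R : realType) (mu b d t : R) :
  (inf_gt mu b d t <= inf_ge mu b d t)%E.
Proof.
apply: le_ereal_inf_tmp => _ [P Pin <-].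
apply: (@le_trans _ _ (P [set x : measurableTypeR R | (t < x)%R])).
  by apply: ereal_inf_lbound; exists P.
apply: le_measure; rewrite ?inE.
- exact: measurable_gt_tail.
- exact: measurable_ge_tail.
- by move=> x /= /ltW.
Qed.

Lemma inf_ge_le_inf_gt (R : realType) (mu b d s t : R) :
  s < t -> (inf_ge mu b d t <= inf_gt mu b d s)%E.
Proof.
move=> st; apply: le_ereal_inf_tmp => _ [P Pin <-].
apply: (@le_trans _ _ (P [set x : measurableTypeR R | (t <= x)%R])).
  by apply: ereal_inf_lbound; exists P.
apply: le_measure; rewrite ?inE.
- exact: measurable_ge_tail.
- exact: measurable_gt_tail.
- by move=> x /=; exact: lt_le_trans.
Qed.

(** The weak infimum at t is squeezed between the strict infimum at t and the
strict infima at the points r < t, which tend to the former by continuity. *)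
Lemma inf_ge_eq_inf_gt (R : realType) (mu b d s t : R) (f : R -> R) :
  s < t -> {for t, continuous f} ->
  (forall r, s <= r <= t -> inf_gt mu b d r = (f r)%:E) ->
  inf_ge mu b d t = inf_gt mu b d t.
Proof.
move=> st fc inf_gtE; apply/eqP; rewrite eq_le inf_gt_le_inf_ge andbT.
rewrite inf_gtE ?lexx ?(ltW st)//.
apply: (cvge_ge (F := t^'-) (f := EFin \o f)).
  near=> r.
  have rt : r < t by near: r; exact: nbhs_left_lt.
  have sr : s <= r by near: r; exact: nbhs_left_ge.
  by rewrite /= -inf_gtE ?sr ?(ltW rt)//; exact: inf_ge_le_inf_gt.
apply: cvg_EFin; last exact: cvg_at_left_filter.
by near=> r.
Unshelve. all: by end_near. Qed.

(** * Consistency of the mean, the range and the absolute deviation *)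

Lemma ambiguity_set_gt_upper (R : realType) (mu b d : R)
    (P : probability (measurableTypeR R) R) :
  ambiguity_set mu b d P -> P [set x : measurableTypeR R | b < (x : R)] = 0%E.
Proof.
move=> [P0b _ _].
have m0b : measurable (`[0, b]%classic : set (measurableTypeR R)).
  exact: measurable_itv.
have out0 : P (~` `[0, b]%classic) = 0%E by rewrite probability_setC// P0b subee.
apply/eqP; rewrite eq_le measure_ge0 andbT -out0.
apply: le_measure; rewrite ?inE.
- exact: measurable_gt_tail.
- exact: measurableC.
- by move=> x /=; rewrite in_itv /= ltNge => /negP xb /andP[_].
Qed.

(** The inequalities are expectations of pointwise ones on [0, b], the second of
them the bound of the convex function |x - mu| by its chord
mu + x (b - 2 mu) / b.  Since d > 0, equality mu = b is impossible. *)
Lemma ambiguity_set_feasible (R : realType) (mu b d : R) :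
  0 < mu -> 0 < d -> ambiguity_set mu b d !=set0 ->
  mu < b /\ d * b <= 2 * mu * (b - mu).
Proof.
move=> mu_gt0 d_gt0 [P Pin].
have le0 a c e : (forall x, 0 <= x <= b -> a + c * x + e * `|x - mu| <= 0) ->
    a + c * mu + e * d <= 0.
  move=> hle; suff : ((a + c * mu + e * d)%:E <= 0)%E by rewrite lee_fin.
  rewrite -(ambiguity_set_gt_upper Pin).
  apply: (le_expectation_tail Pin) => x xb.
  by rewrite ltNge (andP xb).2; exact: hle.
have mu_leb : mu <= b.
  suff : - b + 1 * mu + 0 * d <= 0 by lra.
  by apply: le0 => x /andP[_ xb]; lra.
have feas : - (mu * b) + (2 * mu - b) * mu + b * d <= 0.
  apply: le0 => x /andP[x0 xb].
  by case: (lerP x mu) => xmu; nra.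
have {}feas : d * b <= 2 * mu * (b - mu) by lra.
split=> //; rewrite lt_neqAle mu_leb andbT; apply/eqP => mub; nra.
Qed.

(** * Values of the infimum of the strict tail *)

Lemma le_tau1 (R : realType) (mu b d t : R) : d < 2 * (b - mu) ->
  (t <= tau1 mu b d) = (d * (b - mu) <= (mu - t) * (2 * (b - mu) - d)).
Proof. by move=> db; rewrite /tau1 lerBrDl -lerBrDr ler_pdivrMr// subr_gt0. Qed.

Lemma le_tau2 (R : realType) (mu d t : R) : d < 2 * mu ->
  (t <= tau2 mu d) = ((t - mu) * (2 * mu - d) <= d * mu).
Proof. by move=> dmu; rewrite /tau2 -lerBlDl ler_pdivlMr// subr_gt0. Qed.

Lemma mad_lt_2mean (R : realType) (mu b d : R) :
  0 < mu -> mu < b -> d * b <= 2 * mu * (b - mu) -> d < 2 * mu.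
Proof.
move=> mu_gt0 mu_ltb feas; have b_gt0 : 0 < b by lra.
by rewrite -(ltr_pM2r b_gt0); apply: le_lt_trans feas _; nra.
Qed.

Lemma mad_lt_2gap (R : realType) (mu b d : R) :
  0 < mu -> mu < b -> d * b <= 2 * mu * (b - mu) -> d < 2 * (b - mu).
Proof.
move=> mu_gt0 mu_ltb feas; have b_gt0 : 0 < b by lra.
by rewrite -(ltr_pM2r b_gt0); apply: le_lt_trans feas _; nra.
Qed.

(** Markov's inequality for (mu - X)^+, which is an equality for the law with
atoms at t and at a point y above mu fixed by the mean.  The condition y <= b is
exactly t <= tau1. *)
Lemma inf_gt_low (R : realType) (mu b d t : R) :
  0 < mu -> 0 < d -> mu < b -> d * b <= 2 * mu * (b - mu) ->
  0 <= t <= tau1 mu b d ->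
  inf_gt mu b d t = (1 - d / (2 * (mu - t)))%:E.
Proof.
move=> mu_gt0 d_gt0 mu_ltb feas.
have d_lt_2mu := mad_lt_2mean mu_gt0 mu_ltb feas.
have d_lt_2gap := mad_lt_2gap mu_gt0 mu_ltb feas.
rewrite le_tau1// => /andP[t_ge0 t_le].
have dt : d < 2 * (mu - t).
  rewrite ltNge; apply/negP => le_d.
  have gap : 0 <= 2 * (b - mu) - d by rewrite subr_ge0 ltW.
  by have := ler_wpM2r gap le_d; have := mulr_gt0 d_gt0 d_gt0; lra.
have t_ltmu : t < mu by lra.
apply/eqP; rewrite eq_le; apply/andP; split.
- pose w := d / (2 * (mu - t)).
  pose y := mu + d * (mu - t) / (2 * (mu - t) - d).
  have w_ge0 : 0 <= w by apply: divr_ge0; lra.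
  have w_lt1 : w < 1 by rewrite ltr_pdivrMr; lra.
  have y_gemu : mu <= y by rewrite lerDl; apply: divr_ge0; nra.
  have y_leb : y <= b by rewrite -lerBrDl ler_pdivrMr; nra.
  have := @inf_gt_le_three_atoms R mu b d t t y 0 w (1 - w) 0.
  rewrite ltxx (lt_le_trans t_ltmu y_gemu) [(t < 0)%R]ltNge t_ge0 /=.
  rewrite !mulr0 !mul0r !addr0 mulr1 add0r; apply=> //; try lra.
  + rewrite /w /y; field; lra.
  + rewrite ltr0_norm ?subr_lt0// ger0_norm ?subr_ge0// /w /y; field; lra.
- rewrite (_ : 1 - _ = (1 - mu / (2 * (mu - t))) + 1 / (2 * (mu - t)) * mu
     + - (1 / (2 * (mu - t))) * d); last by field; lra.
  apply: le_inf_gt => x /andP[x_ge0 x_leb].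
  rewrite [leLHS](_ : _ = 1 - (`|x - mu| - (x - mu)) / (2 * (mu - t))); last first.
    by field; lra.
  case: (ltrP t x) => tx /=; rewrite ?lerBlDr ?lerDl.
    by apply: divr_ge0; [have := ler_norm (x - mu)|]; lra.
  by rewrite add0r ler_pdivlMr ?ler0_norm; lra.
Qed.

(** Since (X - mu)^+ is at most b - mu and vanishes for X <= mu, already X > mu
has probability at least d / (2 (b - mu)); concentrating all the mass above mu at
b and the rest at a single point forces that point to be tau1. *)
Lemma inf_gt_middle (R : realType) (mu b d t : R) :
  0 < mu -> 0 < d -> mu < b -> d * b <= 2 * mu * (b - mu) ->
  tau1 mu b d <= t <= mu ->
  inf_gt mu b d t = (d / (2 * (b - mu)))%:E.
Proof.
move=> mu_gt0 d_gt0 mu_ltb feas.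
have d_lt_2mu := mad_lt_2mean mu_gt0 mu_ltb feas.
have d_lt_2gap := mad_lt_2gap mu_gt0 mu_ltb feas.
move=> /andP[t_ge t_lemu].
apply/eqP; rewrite eq_le; apply/andP; split.
- pose w := d / (2 * (b - mu)).
  have w_ge0 : 0 <= w by apply: divr_ge0; lra.
  have w_lt1 : w < 1 by rewrite ltr_pdivrMr; lra.
  have tau_ge0 : 0 <= tau1 mu b d by rewrite le_tau1//; nra.
  have := @inf_gt_le_three_atoms R mu b d t (tau1 mu b d) b 0 (1 - w) w 0.
  rewrite ltNge t_ge (le_lt_trans t_lemu mu_ltb) /=.
  rewrite !mulr0 !mul0r !addr0 mulr1 add0r; apply=> //; try lra.
  + by rewrite /w /tau1; field; lra.
  + rewrite ler0_norm ?subr_le0 ?(le_trans t_ge)// ger0_norm ?subr_ge0 ?(ltW mu_ltb)//.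
    by rewrite /w /tau1; field; lra.
- rewrite (_ : d / _ = - (mu / (2 * (b - mu))) + 1 / (2 * (b - mu)) * mu
     + 1 / (2 * (b - mu)) * d); last by field; lra.
  apply: le_inf_gt => x /andP[x_ge0 x_leb].
  rewrite [leLHS](_ : _ = (`|x - mu| + (x - mu)) / (2 * (b - mu))); last first.
    by field; lra.
  rewrite ler_pdivrMr; last lra.
  case: (ltrP t x) => tx /=; last by rewrite ler0_norm; lra.
  by case: (lerP x mu) => xmu; lra.
Qed.

(** The minorant is (t (x - mu)^+ - (t - mu) x) / (mu (b - t)), equal to 0, 0, 1
at 0, t, b.  For the law on these three points, the deviation below mu fixes the
weight of 0 and the mean fixes the other two: the weight of b is nonnegative
because t <= tau2, that of t because d b <= 2 mu (b - mu). *)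
Lemma inf_gt_high (R : realType) (mu b d t : R) :
  0 < mu -> 0 < d -> mu < b -> d * b <= 2 * mu * (b - mu) ->
  mu <= t <= tau2 mu d -> t < b ->
  inf_gt mu b d t = ((mu - t) / (b - t) + d * t / (2 * mu * (b - t)))%:E.
Proof.
move=> mu_gt0 d_gt0 mu_ltb feas.
have d_lt_2mu := mad_lt_2mean mu_gt0 mu_ltb feas.
have d_lt_2gap := mad_lt_2gap mu_gt0 mu_ltb feas.
rewrite le_tau2// => /andP[mu_let t_le] t_ltb.
have bt_gt0 : 0 < b - t by lra.
apply/eqP; rewrite eq_le; apply/andP; split.
- pose w0 := d / (2 * mu).
  pose w2 := (mu - t) / (b - t) + d * t / (2 * mu * (b - t)).
  have w0_ge0 : 0 <= w0 by apply: divr_ge0; lra.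
  have w2_ge0 : 0 <= w2.
    rewrite (_ : w2 = (2 * mu * (mu - t) + d * t) / (2 * mu * (b - t))).
      by apply: divr_ge0; nra.
    by rewrite /w2; field; lra.
  have w1_ge0 : 0 <= 1 - w0 - w2.
    rewrite (_ : _ - _ = (2 * mu * (b - mu) - d * b) / (2 * mu * (b - t))).
      by apply: divr_ge0; nra.
    by rewrite /w2 /w0; field; lra.
  have := @inf_gt_le_three_atoms R mu b d t 0 t b w0 (1 - w0 - w2) w2.
  rewrite ltxx t_ltb [(t < 0)%R]ltNge (le_trans (ltW mu_gt0) mu_let) /=.
  rewrite !mulr0 !add0r mulr1; apply=> //; try lra.
  + by rewrite /w2 /w0; field; lra.
  + rewrite normrN !ger0_norm ?subr_ge0 ?(ltW mu_gt0) ?(ltW mu_ltb)//.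
    by rewrite /w2 /w0; field; lra.
- rewrite (_ : _ + _ = - (t / (2 * (b - t)))
    + (t / (2 * mu * (b - t)) - (t - mu) / (mu * (b - t))) * mu
    + t / (2 * mu * (b - t)) * d); last by field; lra.
  apply: le_inf_gt => x /andP[x_ge0 x_leb].
  rewrite [leLHS](_ : _ = (t * ((`|x - mu| + (x - mu)) / 2) - (t - mu) * x)
      / (mu * (b - t))); last by field; lra.
  rewrite ler_pdivrMr; last exact: mulr_gt0.
  case: (lerP x mu) => xmu; try lra.
    by case: (ltrP t x) => tx /=; nra.
  by case: (ltrP t x) => tx /=; nra.
Qed.

(** The law with all its mass below mu at 0 and the rest at a single point forces
that point to be tau2, and has no mass beyond t. *)
Lemma inf_gt_top (R : realType) (mu b d t : R) :
  0 < mu -> 0 < d -> mu < b -> d * b <= 2 * mu * (b - mu) ->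
  tau2 mu d <= t -> inf_gt mu b d t = 0%E.
Proof.
move=> mu_gt0 d_gt0 mu_ltb feas.
have d_lt_2mu := mad_lt_2mean mu_gt0 mu_ltb feas.
have d_lt_2gap := mad_lt_2gap mu_gt0 mu_ltb feas.
move=> t_ge; apply/eqP; rewrite eq_le; apply/andP; split; last first.
  by apply: le_ereal_inf_tmp => _ [P _ <-].
pose w := d / (2 * mu).
have w_ge0 : 0 <= w by apply: divr_ge0; lra.
have w_lt1 : w < 1 by rewrite ltr_pdivrMr; lra.
have tau_gemu : mu <= tau2 mu d by rewrite le_tau2//; nra.
have tau_leb : tau2 mu d <= b.
  by rewrite /tau2 -lerBrDl ler_pdivrMr; nra.
have := @inf_gt_le_three_atoms R mu b d t 0 (tau2 mu d) 0 w (1 - w) 0.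
have tau_ge0 : 0 <= tau2 mu d := le_trans (ltW mu_gt0) tau_gemu.
rewrite [(t < 0)%R]ltNge (le_trans tau_ge0 t_ge) [(t < _)%R]ltNge t_ge /=.
rewrite !mulr0 !mul0r !addr0 !add0r; apply=> //; try lra.
+ by rewrite /w /tau2; field; lra.
+ rewrite normrN !ger0_norm ?subr_ge0 ?(ltW mu_gt0)//.
  by rewrite /w /tau2; field; lra.
Qed.

(* At t = 0, and at t = b when tau2 = b, only the strict tail has the stated
   infimum, because P(X >= 0) = 1 and, in the latter case, P(X >= b) = mu / b. *)
Theorem theorem2 (R : realType) (mu b d : R)
    (mu_gt0 : 0 < mu) (b_gt0 : 0 < b) (d_gt0 : 0 < d)
    (nonempty : ambiguity_set mu b d !=set0)
    (t : R) (t_ge0 : 0 <= t) (t_leb : t <= b) :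
  (0 < t -> t < b \/ tau2 mu d < b ->
     inf_ge mu b d t = inf_gt mu b d t) /\
  tail_value mu b d t (inf_gt mu b d t).
Proof.
have [mu_ltb feas] := ambiguity_set_feasible mu_gt0 d_gt0 nonempty.
have d_lt_2mu := mad_lt_2mean mu_gt0 mu_ltb feas.
have d_lt_2gap := mad_lt_2gap mu_gt0 mu_ltb feas.
have low r := @inf_gt_low R mu b d r mu_gt0 d_gt0 mu_ltb feas.
have middle r := @inf_gt_middle R mu b d r mu_gt0 d_gt0 mu_ltb feas.
have high r := @inf_gt_high R mu b d r mu_gt0 d_gt0 mu_ltb feas.
have top r := @inf_gt_top R mu b d r mu_gt0 d_gt0 mu_ltb feas.
have tau1_lt_mu : tau1 mu b d < mu by rewrite ltNge le_tau1//; nra.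
have mu_lt_tau2 : mu < tau2 mu d.
  by rewrite /tau2 ltrDl divr_gt0 ?mulr_gt0 ?subr_gt0.
split.
  move=> t_gt0 inside.
  (* On each range the closed formula also holds on a left neighbourhood of t. *)
  have [t_le1|t_gt1] := lerP t (tau1 mu b d).
    apply: (@inf_ge_eq_inf_gt R mu b d 0 t (fun r => 1 - d / (2 * (mu - r)))) => //.
      apply: cvgB; first exact: cvg_cst.
      apply: cvgMr; apply: cvgV; first by lra.
      by apply: cvgMr; apply: cvgB; [exact: cvg_cst|exact: cvg_id].
    by move=> r /andP[r_ge0 r_let]; rewrite low// r_ge0 (le_trans r_let).
  have [t_lemu|t_gtmu] := lerP t mu.
    apply: (@inf_ge_eq_inf_gt R mu b d (tau1 mu b d) t (cst (d / (2 * (b - mu))))) => //.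
      exact: cvg_cst.
    by move=> r /andP[r_ge1 r_let]; rewrite middle// r_ge1 (le_trans r_let).
  have [t_le2|t_gt2] := lerP t (tau2 mu d).
    have t_ltb : t < b by case: inside => //; exact: le_lt_trans.
    apply: (@inf_ge_eq_inf_gt R mu b d mu t
      (fun r => (mu - r) / (b - r) + d * r / (2 * mu * (b - r)))) => //.
      apply: cvgD; apply: cvgM.
      - by apply: cvgB; [exact: cvg_cst|exact: cvg_id].
      - apply: cvgV; first by lra.
        by apply: cvgB; [exact: cvg_cst|exact: cvg_id].
      - by apply: cvgMr; exact: cvg_id.
      - apply: cvgV; first by rewrite mulf_neq0//; lra.
        by apply: cvgMr; apply: cvgB; [exact: cvg_cst|exact: cvg_id].
    move=> r /andP[r_gemu r_let].
    by rewrite high ?r_gemu ?(le_trans r_let) ?(le_lt_trans r_let).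
  apply: (@inf_ge_eq_inf_gt R mu b d (tau2 mu d) t (cst 0)) => //.
    exact: cvg_cst.
  by move=> r /andP[r_ge2 _]; exact: top.
split.
- by move=> /low.
- by move=> /middle.
(* The formula has denominator 0 at t = b and then reads 0, which is the value
   there because tau2 <= b. *)
- move=> t_high; have [t_ltb|b_let] := ltrP t b; first exact: high.
  have tb : t = b by apply/eqP; rewrite eq_le t_leb.
  rewrite [b - t](_ : _ = 0); last by rewrite tb subrr.
  rewrite mulr0 invr0 !mulr0 addr0; apply: top.
  rewrite tb /tau2 -lerBrDl ler_pdivrMr; nra.
- by move=> /andP[t_ge2 _]; exact: top.
Qed.
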